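(* Let $Q$ be a complete connected Riemannian manifold with metric $g$ and distance $d$, let $s\ge2$, $T>0$, let $\mathbb{G}=(\mathcal{V},\mathcal{E})$ be an undirected graph on $\mathcal{V}=\{1,\dots,s\}$, and fix boundary data $q_i^0,q_i^T\in Q$, $v_i^0\in T_{q_i^0}Q$, $v_i^T\in T_{q_i^T}Q$. Let $V_{ij}:Q\times Q\to\mathbb{R}$, $(i,j)\in\mathcal{E}$, be $C^1$, non-negative, with $V_{ij}=V_{ji}$ and $V_{ij}(p,q)=V_{ij}(q,p)$. For each $(i,j)\in\mathcal{E}$ let $r_{ij}=r_{ji}>0$ and $V_{ij}^*>0$ be real numbers such that $V_{ij}(p,q)>V_{ij}^*$ whenever $d(p,q)<r_{ij}$, and set $V_{ij}^-=V_{ij}(q_i^0,q_j^0)$. Let $v_i^{\max},a_i^{\max},\eta_i^{\max}\ge0$ with $v_i^{\max}>\max\{\|v_i^0\|,\|v_i^T\|\}$ for each $i\in\mathcal{V}$. Suppose that $q=(q_1,\dots,q_s)\in\Omega^{\max}=\Omega_1^{\max}\times\cdots\times\Omega_s^{\max}$ and that each $q_i$ satisfies on $[0,T]$ $$\frac{D^4q_i}{dt^4}+R\Big(\frac{D^2q_i}{dt^2},\frac{dq_i}{dt}\Big)\frac{dq_i}{dt}=-\sum_{j\in\mathcal{N}_i}\mathrm{grad}_1V_{ij}(q_i(t),q_j(t)).$$ Set $\eta_i^0=\frac{D^2}{dt^2}\dot q_i(0)$. If $$V_{ij}^*>\sum_{l=1}^s\Big[(a_l^{\max})^2+v_l^{\max}\eta_l^{\max}+g(v_l^0,\eta_l^0)+\frac12\sum_{m\in\mathcal{N}_l}V_{lm}^-\Big]\quad\text{for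 all }(i,j)\in\mathcal{E},$$ then $q$ avoids collision with tolerances $r_{ij}$, i.e. $d(q_i(t),q_j(t))\ge r_{ij}$ for all $(i,j)\in\mathcal{E}$ and $t\in[0,T]$.
   Context: $\|\cdot\|$ is the norm of $g$ and $\frac{D}{dt}$ is covariant differentiation along curves for the Levi-Civita connection $\nabla$. $\frac{D^{k+1}q}{dt^{k+1}}=\frac{D^k}{dt^k}\dot q$ is the $k$-th covariant derivative of the velocity. The curvature convention is $R(X,Y)Z=\nabla_X\nabla_YZ-\nabla_Y\nabla_XZ-\nabla_{[X,Y]}Z$. $\mathrm{grad}_1$ is the Riemannian gradient in the first argument. $\mathcal{E}\subseteq\mathcal{V}\times\mathcal{V}$ is symmetric and $\mathcal{N}_i=\{j:(i,j)\in\mathcal{E}\}$ (other agents, so $i\notin\mathcal{N}_i$). $\Omega_i$ is the set of $C^1$ piecewise smooth curves $q:[0,T]\to Q$ with $q(0)=q_i^0$, $\dot q(0)=v_i^0$, $q(T)=q_i^T$, $\dot q(T)=v_i^T$, and $$\Omega_i^{\max}=\Big\{q\in\Omega_i:\ \|\dot q(t)\|\le v_i^{\max},\ \Big\|\frac{D}{dt}\dot q(t)\Big\|\le a_i^{\max},\ \Big\|\frac{D^2}{dt^2}\dot q(t)\Big\|\le\eta_i^{\max}\ \ \forall t\in[0,T]\Big\}.$$ That $q_i$ satisfies the differential equation on $[0,T]$ includes that the covariant derivatives up to fourth order exist on all of $[0,T]$. *)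

(* Defs.v *)
From HB Require Import structures.
From mathcomp Require Import all_boot all_order all_algebra.
From mathcomp Require Import all_classical all_reals all_analysis.

Set Implicit Arguments.
Unset Strict Implicit.
Unset Printing Implicit Defensive.

Import Order.TTheory GRing.Theory Num.Theory.
Import numFieldNormedType.Exports.

Local Open Scope classical_set_scope.
Local Open Scope ring_scope.

(* [f] is C^k on the open set [U].  For finite-dimensional [V], which is the
   only case used, quantifying over all directions [v] is the same as
   quantifying over partial derivatives. *)
Fixpoint Ck {R : realType} {V W : normedModType R} (k : nat) (U : set V)
    (f : V -> W) : Prop :=
  if k is k'.+1 then
    (forall x, U x -> differentiable f x) /\
    (forall v, Ck k' U (fun x => 'D_v f x))
  else forall x, U x -> {for x, continuous f}.

Definition smooth {R : realType} {V W : normedModType R} (U : set V)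
  (f : V -> W) : Prop := forall k, Ck k U f.

(* Derivative of [f] at [t] relative to a set of times [A] (in practice a
   closed interval): two-sided in the interior, one-sided at the end points. *)
Definition derivable_within {R : realType} {W : normedModType R} (A : set R)
    (f : R -> W) (t : R) : Prop :=
  cvg ((s - t)^-1 *: (f s - f t) @[s --> within A t^']).

Definition derive_within {R : realType} {W : normedModType R} (A : set R)
    (f : R -> W) (t : R) : W :=
  lim ((s - t)^-1 *: (f s - f t) @[s --> within A t^']).

(* A homeomorphism between an open subset of [Q] and an open subset of R^n;
   [cmap] and [cinv] are total functions, meaningful on [cdom] and [cimg]. *)
Record chart (R : realType) (Q : topologicalType) (n : nat) := Chart {
  cdom : set Q ;
  cimg : set 'rV[R]_n ;
  cmap :> Q -> 'rV[R]_n ;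
  cinv : 'rV[R]_n -> Q ;
  cdom_open : open cdom ;
  cimg_open : open cimg ;
  cmap_img : forall p, cdom p -> cimg (cmap p) ;
  cinv_dom : forall x, cimg x -> cdom (cinv x) ;
  cmapK : forall p, cdom p -> cinv (cmap p) = p ;
  cinvK : forall x, cimg x -> cmap (cinv x) = x ;
  cmap_cont : forall p, cdom p -> {for p, continuous cmap} ;
  cinv_cont : forall x, cimg x -> {for x, continuous cinv}
}.

(* The smooth structure is given by an atlas indexed by the points, the chart
   [chart_at p] being defined around [p].  Any smooth atlas yields one, by
   choosing a chart around each point, and the two are compatible. *)
Record manifold (R : realType) (n : nat) := Manifold {
  msort :> topologicalType ;
  m_hausdorff : hausdorff_space msort ;
  m_second_countable : @second_countable msort ;
  chart_at : msort -> chart R msort n ;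
  chart_atP : forall p, cdom (chart_at p) p ;
  chart_at_smooth : forall p q : msort,
    smooth (cimg (chart_at p) `&` cinv (chart_at p) @^-1` cdom (chart_at q))
      (chart_at q \o cinv (chart_at p))
}.

(* A tangent vector at [p] is represented by its components in the chart
   [chart_at p]. *)
Definition tangent {R : realType} {n : nat} {Q : manifold R n} (p : Q) : Type :=
  'rV[R]_n.

(* Components in the chart [c] of a tangent vector at [p]. *)
Definition tcoord {R : realType} {n : nat} {Q : manifold R n}
    (c : chart R Q n) (p : Q) (v : tangent p) : 'rV[R]_n :=
  'd (c \o cinv (chart_at p)) (chart_at p p) v.

(* The tangent vector at [cinv c x] whose components in the chart [c] are
   [u]. *)
Definition tvect {R : realType} {n : nat} {Q : manifold R n}
    (c : chart R Q n) (x u : 'rV[R]_n) : tangent (cinv c x) :=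
  'd (chart_at (cinv c x) \o cinv c) x u.

Record riemannian (R : realType) (n : nat) := Riemannian {
  rmanifold :> manifold R n ;
  metric : forall p : rmanifold, tangent p -> tangent p -> R ;
  metric_linear : forall (p : rmanifold) (w : tangent p) (a : R)
    (u v : 'rV[R]_n), metric (a *: u + v : tangent p) w
                      = a * metric (u : tangent p) w + metric (v : tangent p) w ;
  metric_sym : forall (p : rmanifold) (u v : tangent p),
    metric u v = metric v u ;
  metric_pos : forall (p : rmanifold) (u : tangent p),
    u != 0 :> 'rV[R]_n -> 0 < metric u u ;
  metric_smooth : forall (p : rmanifold) (u v : 'rV[R]_n),
    smooth (cimg (chart_at p))
      (fun x => metric (tvect (chart_at p) x u) (tvect (chart_at p) x v) : R^o)
}.

Section Geometry.
Context {R : realType} {n : nat} {Q : riemannian R n}.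
Implicit Types (p : Q) (c : chart R Q n) (x u v w : 'rV[R]_n).

Definition tnorm p (v : tangent p) : R := Num.sqrt (metric v v).

Definition lmetric c x u v : R^o := metric (tvect c x u) (tvect c x v).

Definition gram c x : 'M[R]_n :=
  \matrix_(i, j) lmetric c x (delta_mx 0 i) (delta_mx 0 j).

(* The Levi-Civita connection in the chart [c]: the k-th component is
     Gamma^k_ij u^i v^j = 1/2 g^kl (d_i g_jl + d_j g_il - d_l g_ij) u^i v^j. *)
Definition christoffel c x u v : 'rV[R]_n :=
  2^-1 *: ((\row_l ('D_u (fun y => lmetric c y v (delta_mx 0 l)) x
                    + 'D_v (fun y => lmetric c y u (delta_mx 0 l)) x
                    - 'D_(delta_mx 0 l) (fun y => lmetric c y u v) x))
           *m invmx (gram c x)).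

(* [nabla c X Y] and [lie X Y] are nabla_X Y and [X, Y] for vector fields [X]
   and [Y] given by their components in the chart [c]. *)
Definition nabla c (X Y : 'rV[R]_n -> 'rV[R]_n) x : 'rV[R]_n :=
  'D_(X x) Y x + christoffel c x (X x) (Y x).

Definition lie (X Y : 'rV[R]_n -> 'rV[R]_n) x : 'rV[R]_n :=
  'D_(X x) Y x - 'D_(Y x) X x.

Definition curvature_field c (X Y Z : 'rV[R]_n -> 'rV[R]_n) x : 'rV[R]_n :=
  nabla c X (nabla c Y Z) x - nabla c Y (nabla c X Z) x - nabla c (lie X Y) Z x.

(* R(u, v) w at [p]; by tensoriality the three vectors may be extended by
   fields with constant components in the chart [chart_at p]. *)
Definition curvature p (u v w : tangent p) : tangent p :=
  curvature_field (chart_at p) (cst u) (cst v) (cst w) (chart_at p p).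

Definition grad (f : Q -> R) p : tangent p :=
  get [set G : 'rV[R]_n | forall w : 'rV[R]_n,
    metric (G : tangent p) (w : tangent p) =
    'd ((f : Q -> R^o) \o cinv (chart_at p)) (chart_at p p) w].

Definition grad1 (V : Q -> Q -> R) p q : tangent p := grad (V^~ q) p.

Definition C1_potential (V : Q -> Q -> R) : Prop :=
  forall p q : Q, Ck 1 (cimg (chart_at p) `*` cimg (chart_at q))
    (fun z => V (cinv (chart_at p) z.1) (cinv (chart_at q) z.2) : R^o).

(* A curve on a closed interval [A] is a function [R -> Q] of which only the
   restriction to [A] is considered. *)

Definition velocity (A : set R) (q : R -> Q) (t : R) : tangent (q t) :=
  derive_within A (chart_at (q t) \o q) t.

Definition C1_curve (A : set R) (q : R -> Q) : Prop :=
  {within A, continuous q} /\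
  forall t, A t ->
    let f := chart_at (q t) \o q in
    (\forall s \near within A (nbhs t), derivable_within A f s) /\
    derive_within A f s @[s --> within A (nbhs t)] --> derive_within A f t.

Definition smooth_curve (A : set R) (q : R -> Q) : Prop :=
  {within A, continuous q} /\
  forall t, A t -> forall k,
    \forall s \near within A (nbhs t),
      derivable_within A (iter k (derive_within A) (chart_at (q t) \o q)) s.

Definition piecewise (P : set R -> (R -> Q) -> Prop) (a b : R) (q : R -> Q) :
    Prop :=
  exists (m : nat) (tau : nat -> R), tau 0%N = a /\ tau m = b /\
    forall i, (i < m)%N ->
      tau i < tau i.+1 /\ P `[tau i, tau i.+1]%classic q.

Definition cov_derivable (A : set R) (q : R -> Q)
    (X : forall t, tangent (q t)) (t : R) : Prop :=
  derivable_within A (fun s => tcoord (chart_at (q t)) (X s)) t.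

Definition cov_derive (A : set R) (q : R -> Q)
    (X : forall t, tangent (q t)) (t : R) : tangent (q t) :=
  derive_within A (fun s => tcoord (chart_at (q t)) (X s)) t
  + christoffel (chart_at (q t)) (chart_at (q t) (q t))
      (velocity A q t) (X t).

(* D^k/dt^k of the velocity, i.e. D^(k+1) q/dt^(k+1). *)
Fixpoint cov_velocity (A : set R) (q : R -> Q) (k : nat) :
    forall t, tangent (q t) :=
  if k is k'.+1 then cov_derive A (cov_velocity A q k') else velocity A q.

(* The covariant derivatives up to D^k/dt^k of the velocity exist on [A]. *)
Definition cov_velocity_exists (A : set R) (q : R -> Q) (k : nat) : Prop :=
  (forall t, A t -> derivable_within A (chart_at (q t) \o q) t) /\
  forall j, (j < k)%N -> forall t, A t ->
    cov_derivable A (cov_velocity A q j) t.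

(* The finitely many break points of a piecewise C^1 curve, where the velocity
   is unspecified, do not contribute to the integral. *)
Definition curve_length (q : R -> Q) : R :=
  \int[@lebesgue_measure R]_(t in `[0, 1]) tnorm (velocity `[0, 1]%classic q t).

Definition dist (p p' : Q) : R :=
  inf [set curve_length q | q in [set q : R -> Q |
    piecewise C1_curve 0 1 q /\ q 0 = p /\ q 1 = p']].

Definition complete_riemannian : Prop :=
  forall x : nat -> Q,
    (forall e : R, 0 < e -> exists N, forall i j,
      (N <= i)%N -> (N <= j)%N -> dist (x i) (x j) < e) ->
    exists l : Q, (dist (x k) l : R^o) @[k --> \oo] --> (0 : R^o).

(* The end point velocities are compared by their components in
   [chart_at (q 0)] and [chart_at (q T)], which are the charts of the
   prescribed vectors by the end point conditions. *)
Definition Omega (T : R) (q0 qT : Q) (v0 : tangent q0) (vT : tangent qT) :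
    set (R -> Q) :=
  [set q | [/\ C1_curve `[0, T]%classic q,
               piecewise smooth_curve 0 T q,
               q 0 = q0 /\ velocity `[0, T]%classic q 0 = v0 :> 'rV[R]_n
             & q T = qT /\ velocity `[0, T]%classic q T = vT :> 'rV[R]_n]].

Definition Omega_max (T : R) (q0 qT : Q) (v0 : tangent q0) (vT : tangent qT)
    (vmax amax etamax : R) : set (R -> Q) :=
  [set q | [/\ Omega T v0 vT q,
               cov_velocity_exists `[0, T]%classic q 2
             & forall t, 0 <= t <= T ->
                 [/\ tnorm (velocity `[0, T]%classic q t) <= vmax,
                     tnorm (cov_velocity `[0, T]%classic q 1 t) <= amax
                   & tnorm (cov_velocity `[0, T]%classic q 2 t) <= etamax]]].

End Geometry.

Arguments complete_riemannian {R n} Q.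

(* Main.v *)
Require Import Defs.
From HB Require Import structures.
From mathcomp Require Import all_boot all_order all_algebra.
From mathcomp Require Import all_classical all_reals all_analysis.
From mathcomp Require Import ring lra.

Set Implicit Arguments.
Unset Strict Implicit.
Unset Printing Implicit Defensive.

Import Order.TTheory GRing.Theory Num.Theory.
Import numFieldNormedType.Exports.

Local Open Scope classical_set_scope.
Local Open Scope ring_scope.

(* With v = dq/dt, metric compatibility and g(R(X, v)v, v) = 0 turn the equation
   of motion into conservation of
     sum_l [ g(v_l, D^2 v_l) - |D v_l|^2 / 2 + 1/2 sum_m V_lm(q_l, q_m) ],
   the symmetries of V_lm pairing the gradient terms.  Bounding the kinetic
   part at time t by Cauchy-Schwarz leaves V_ij(q_i, q_j) at most the sum
   in the hypothesis, hence below V_ij^*. *)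

(** Tangent vectors at different points are written in unrelated charts, so g(X, Y) along a curve
    has no single coordinate formula. At each time t all nearby vectors are therefore carried to the
    chart around q(t), the one in which the covariant derivative at t is defined; the Christoffel
    terms then come from differentiating the metric coefficients. The equation is used only at
    interior times, where derivatives relative to [0, T] are two-sided; continuity carries the
    conserved quantity to the end points, so that it can be evaluated at t = 0. There -|D v_l|^2 / 2
    is dropped, which leaves g(v_l^0, eta_l^0). The factor 1/2 before the potentials compensates for
    a sum over ordered pairs, which meets every edge twice. *)

(** * Derivatives *)

Section WithinDerivatives.
Context {R : realType} {W : normedModType R}.
Implicit Types (A : set R) (f : R -> W) (t : R).

Lemma within_dnbhs_interior A t : A° t -> within A t^' = t^'.
Proof.
move=> At; rewrite eqEsubset; split=> P; last by move=> tP; apply: filterS tP => x Px _.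
rewrite /within /= => PA.
have At' : t^' A := nbhs_dnbhs At.
by apply: filterS2 At' PA => x Ax; apply.
Qed.

(** The right-hand side is the quotient through which the derivative in the direction 1 is defined;
    the substitution s = h + t links it to [derive_within]. *)
Lemma cvg_quotient_dnbhs f t :
  (s - t)^-1 *: (f s - f t) @[s --> t^'] =
  (h^-1 *: (f (h *: 1 + t) - f t)) @[h --> 0^'].
Proof.
rewrite predeqE => P.
suff H : (\forall s \near t, s != t -> P ((s - t)^-1 *: (f s - f t))) <->
    \forall h \near (0 : R), h != 0 -> P (h^-1 *: (f (h *: 1 + t) - f t)) by exact: H.
rewrite (near_shift 0 t) /= subr0; split; apply: filterS => h /=;
  rewrite /shift /= addrK [h *: 1]mulr1 -[h + t == t]subr_eq0 addrK //.
Qed.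

Lemma derivable_within_interior A f t :
  A° t -> derivable_within A f t -> derivable f t 1.
Proof.
by move=> At; rewrite /derivable_within within_dnbhs_interior // cvg_quotient_dnbhs.
Qed.

Lemma derive_within_interior A f t :
  A° t -> derive_within A f t = 'D_1 f t.
Proof.
by move=> At; rewrite /derive_within within_dnbhs_interior // cvg_quotient_dnbhs.
Qed.

Lemma derivable_within_cvg A f t :
  derivable_within A f t -> f s @[s --> within A (nbhs t)] --> f t.
Proof.
move=> /cvg_ex[l fl].
have st0 : (s - t : R) @[s --> within A t^'] --> (0 : R).
  have : (s - t : R) @[s --> t] --> (t - t : R).
    by apply: cvgB; [exact: cvg_id|exact: cvg_cst].
  rewrite subrr; apply: cvg_trans; apply: cvg_fmap2.
  move=> P tP; have := nbhs_dnbhs (tP : nbhs t P).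
  by rewrite /within /=; apply: filterS => s Ps _.
have FF : Filter (within A t^') by apply: within_filter.
have h0 : (s - t) *: ((s - t)^-1 *: (f s - f t)) @[s --> within A t^'] --> (0 : W).
  by rewrite -(scale0r l); exact: cvgZ.
move/cvgrPdist_lt : h0 => h; apply/cvgrPdist_lt => e e0.
have P : \forall s \near t, s != t -> A s ->
    `|0 - (s - t) *: ((s - t)^-1 *: (f s - f t))| < e by exact: h.
suff : \forall s \near t, A s -> `|f t - f s| < e by exact.
apply: filterS P => s Ps As.
have [->|st] := eqVneq s t; first by rewrite subrr normr0.
move: (Ps st As); rewrite scalerA divff ?subr_eq0 // scale1r sub0r normrN.
by rewrite distrC.
Qed.

End WithinDerivatives.

(** * Symmetry of mixed second derivatives *)

Section MixedDerivatives.
Context {R : realType} {V : normedModType R}.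
Implicit Types (f : V -> R^o) (u v x z : V) (U : set V).

Lemma is_derive_line f u z (a : R) :
  derivable f (z + a *: u) u ->
  is_derive a 1 (fun r => f (z + r *: u)) ('D_u f (z + a *: u)).
Proof.
move=> df; pose g := fun h : R => h^-1 *: (f (h *: u + (z + a *: u)) - f (z + a *: u)).
have gE : (fun h : R => h^-1 *: (((fun r : R => f (z + r *: u)) \o shift a) (h *: 1)
    - f (z + a *: u))) = g.
  apply/funext => h; rewrite /g /= /shift /= [h *: 1]mulr1.
  by rewrite scalerDl addrCA.
by apply: DeriveDef; rewrite /derivable /derive gE.
Qed.

Lemma continuous_ball U (g1 g2 : V -> R^o) x (e : R) : open U -> U x ->
  {for x, continuous g1} -> {for x, continuous g2} -> 0 < e ->
  exists2 d : R, 0 < d & forall y, `|x - y| < d ->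
    [/\ U y, `|g1 x - g1 y| < e & `|g2 x - g2 y| < e].
Proof.
move=> oU Ux /cvgrPdist_lt c1 /cvgrPdist_lt c2 e0.
have nU : nbhs x U by exact: open_nbhs_nbhs.
have /nbhs_normP[d /= d0 dP] : \forall y \near x,
    [/\ U y, `|g1 x - g1 y| < e & `|g2 x - g2 y| < e].
  by move: (c1 _ e0) (c2 _ e0); apply: filterS3 nU => y Uy h1 h2; split.
by exists d => // y xy; exact: dP.
Qed.

(** Two uses of the mean value theorem: first on a -> f(x + s v + a u) - f(x + a u), then on b ->
    D_u f(x + a u + b v). The left-hand side of the equation is symmetric in [u] and [v], which
    [derive_comm] exploits. *)
Lemma mixed_difference U f u v x (s : R) : 0 < s ->
  (forall a b, 0 <= a <= s -> 0 <= b <= s -> U (x + a *: u + b *: v)) ->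
  (forall y, U y -> differentiable f y) ->
  (forall y, U y -> differentiable (fun z => 'D_u f z) y) ->
  exists a b, [/\ 0 <= a <= s, 0 <= b <= s &
    f (x + s *: u + s *: v) - f (x + s *: u) - f (x + s *: v) + f x =
    s ^+ 2 * 'D_v (fun z => 'D_u f z) (x + a *: u + b *: v)].
Proof.
move=> s0 sU df ddf.
have s0s : 0 <= s <= s by rewrite lexx ltW.
have z0s : 0 <= (0 : R) <= s by rewrite lexx ltW.
have itvE (c : R) : c \in `]0, s[ -> 0 <= c <= s.
  by rewrite in_itv /= => /andP[? ?]; rewrite !ltW.
pose phi (a : R) := f (x + s *: v + a *: u) - f (x + a *: u) : R^o.
pose dphi (a : R) := 'D_u f (x + s *: v + a *: u) - 'D_u f (x + a *: u).
have Uphi a : 0 <= a <= s -> U (x + s *: v + a *: u) /\ U (x + a *: u).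
  move=> ha; split; first by rewrite addrAC; exact: sU.
  by rewrite -[_ + _]addr0 -(scale0r v); exact: sU.
have isphi a : 0 <= a <= s -> is_derive a 1 phi (dphi a).
  move=> /Uphi[U1 U2]; apply: is_deriveB; apply: is_derive_line;
    apply: diff_derivable; exact: df.
have [a sa phia] : exists2 a, a \in `]0, s[ & phi s - phi 0 = dphi a * (s - 0).
  apply: (@MVT R phi dphi) => [//|a /itvE /isphi //|].
  apply: derivable_within_continuous => a; rewrite in_itv /= => /isphi H.
  exact: ex_derive.
pose psi (b : R) := 'D_u f (x + a *: u + b *: v) : R^o.
pose dpsi (b : R) := 'D_v (fun z => 'D_u f z) (x + a *: u + b *: v) : R^o.
have ispsi b : 0 <= b <= s -> is_derive b 1 psi (dpsi b).
  move=> hb; apply: (@is_derive_line (fun z => 'D_u f z)).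
  by apply: diff_derivable; apply: ddf; apply: sU => //; exact: itvE.
have [b sb psib] : exists2 b, b \in `]0, s[ & psi s - psi 0 = dpsi b * (s - 0).
  apply: (@MVT R psi dpsi) => [//|b /itvE /ispsi //|].
  apply: derivable_within_continuous => b; rewrite in_itv /= => /ispsi H.
  exact: ex_derive.
exists a, b; split; [exact: itvE|exact: itvE|].
have -> : s ^+ 2 * 'D_v (fun z => 'D_u f z) (x + a *: u + b *: v) =
    s * (dpsi b * (s - 0)).
  by rewrite subr0 /dpsi; ring.
have -> : dpsi b * (s - 0) = dphi a.
  rewrite -psib /psi /dphi scale0r addr0.
  by rewrite [x + s *: v + _]addrAC.
rewrite mulrC -[s in RHS]subr0 -phia /phi !scale0r !addr0 [x + s *: v + _]addrAC.
by ring.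
Qed.

(** Computing the same second difference in both orders makes the two mixed derivatives agree at two
    possibly different points of a small parallelogram; their continuity at [x] does the rest. *)
Lemma derive_comm U f u v x : open U -> U x -> Ck 2 U f ->
  'D_u (fun z => 'D_v f z) x = 'D_v (fun z => 'D_u f z) x.
Proof.
move=> oU Ux [df C1f].
have [dduf cduf] := C1f u; have [ddvf cdvf] := C1f v.
pose g1 := fun y => 'D_u (fun z => 'D_v f z) y : R^o.
pose g2 := fun y => 'D_v (fun z => 'D_u f z) y : R^o.
have c1 : {for x, continuous g1} by exact: cdvf.
have c2 : {for x, continuous g2} by exact: cduf.
suff g12 : g1 x - g2 x = 0 by apply/eqP; rewrite -subr_eq0; apply/eqP.
apply/eqP; rewrite -normr_le0; apply/ler_addgt0Pr => e e0; rewrite add0r.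
have e2 : 0 < e / 2 by rewrite divr_gt0.
have [d d0 dP] := continuous_ball oU Ux c1 c2 e2.
(* Chosen so that s (|u| + |v|) < d / 2, which keeps the whole parallelogram inside the ball of
   radius [d]; the summand 1 covers u = v = 0. *)
pose s := d / (1 + `|u| + `|v|) / 2.
have k0 : 0 < 1 + `|u| + `|v| by rewrite -addrA ltr_wpDr // addr_ge0.
have s0 : 0 < s by rewrite !divr_gt0.
have sd (a b : R) : 0 <= a <= s -> 0 <= b <= s -> `|x - (x + a *: u + b *: v)| < d.
  move=> /andP[a0 as_] /andP[b0 bs].
  rewrite -addrA opprD addrA subrr sub0r normrN.
  apply: (le_lt_trans (ler_normD _ _)); rewrite !normrZ !ger0_norm //.
  apply: (@le_lt_trans _ _ (s * `|u| + s * `|v|)).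
    by apply: lerD; apply: ler_wpM2r.
  apply: (@lt_trans _ _ (s * (1 + `|u| + `|v|))).
    by rewrite !mulrDr mulr1 -addrA ltrDr.
  rewrite /s mulrAC divfK ?gt_eqF // ltr_pdivrMr // mulr_natr.
  by rewrite mulr2n ltrDr.
have sU (a b : R) : 0 <= a <= s -> 0 <= b <= s -> U (x + a *: u + b *: v).
  by move=> ha hb; have [] := dP _ (sd a b ha hb).
have sU' (a b : R) : 0 <= a <= s -> 0 <= b <= s -> U (x + a *: v + b *: u).
  by move=> ha hb; rewrite addrAC; exact: sU.
have [a [b [ha hb E1]]] := mixed_difference s0 sU df dduf.
have [a' [b' [ha' hb' E2]]] := mixed_difference s0 sU' df ddvf.
have E : g2 (x + a *: u + b *: v) = g1 (x + b' *: u + a' *: v).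
  have s2 : s ^+ 2 != 0 by rewrite expf_neq0 // gt_eqF.
  apply: (mulfI s2); apply: etrans (esym E1) _.
  rewrite [x + b' *: u + _]addrAC; apply: etrans E2.
  by rewrite [x + s *: v + _]addrAC; congr (_ + _); exact: addrAC.
clearbody g1 g2.
have [_ _ h2] := dP _ (sd a b ha hb).
have [_ h1 _] := dP _ (sd b' a' hb' ha').
have -> : g1 x - g2 x =
    (g1 x - g1 (x + b' *: u + a' *: v)) - (g2 x - g2 (x + a *: u + b *: v)).
  by rewrite E opprB addrA subrK.
rewrite (le_trans (ler_normB _ _)) // [leRHS]splitr.
by rewrite lerD // ltW.
Qed.

End MixedDerivatives.

Lemma derive0_constant {R : realType} (f : R -> R) (a b : R) :
  (forall x, x \in `]a, b[ -> is_derive x 1 f 0) ->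
  {within `[a, b], continuous f} -> forall x, a <= x <= b -> f x = f a.
Proof.
move=> df cf x /andP[ax xb].
have [||c _] := @MVT_segment R f (cst 0) a x ax; last first.
- by rewrite mul0r => /eqP; rewrite subr_eq0 => /eqP.
- apply: continuous_subspaceW cf => y /=; rewrite !in_itv /= => /andP[-> yx].
  exact: le_trans xb.
- move=> y; rewrite in_itv /= => /andP[ay yx]; apply: df.
  by rewrite in_itv /= ay (lt_le_trans yx).
Qed.

(** * Symmetric bilinear forms *)

Section SymmetricForms.
Context {R : realType} {n : nat} (b : 'rV[R]_n -> 'rV[R]_n -> R).
Hypothesis b_linear : forall w a u v, b (a *: u + v) w = a * b u w + b v w.
Hypothesis b_sym : forall u v, b u v = b v u.

Lemma formDl u v w : b (u + v) w = b u w + b v w.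
Proof. by rewrite -[u in LHS]scale1r b_linear mul1r. Qed.

Lemma form0l w : b 0 w = 0.
Proof. by apply: (@addIr _ (b 0 w)); rewrite -formDl !add0r. Qed.

Lemma formZl a u w : b (a *: u) w = a * b u w.
Proof. by rewrite -[_ *: _]addr0 b_linear form0l addr0. Qed.

Lemma formNl u w : b (- u) w = - b u w.
Proof. by rewrite -scaleN1r formZl mulN1r. Qed.

Lemma formDr w u v : b w (u + v) = b w u + b w v.
Proof. by rewrite b_sym formDl !(b_sym _ w). Qed.

Lemma formZr a w u : b w (a *: u) = a * b w u.
Proof. by rewrite b_sym formZl b_sym. Qed.

Lemma formNr w u : b w (- u) = - b w u.
Proof. by rewrite b_sym formNl b_sym. Qed.

(** The algebra behind [curvature_orthogonal]: the hypothesis has the shape of two equal mixed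
    second derivatives of g(v, v). Symmetry removes the terms in [c] and [d], and what remains is
    the curvature paired with [v]. *)
Lemma form_mixed_cancel (b1 b2 c d e1 e2 v : 'rV[R]_n) :
  2 * (b b1 v + b c d + b e1 v) = 2 * (b b2 v + b d c + b e2 v) ->
  b (e1 + b1 - (e2 + b2)) v = 0.
Proof. by rewrite (b_sym d c) formDl formNl !formDl => H; lra. Qed.

Lemma form_suml (I : finType) (P : pred I) (F : I -> 'rV[R]_n) w :
  b (\sum_(i | P i) F i) w = \sum_(i | P i) b (F i) w.
Proof. by apply: (big_morph (b^~ w)) => [u v|]; [exact: formDl|exact: form0l]. Qed.

Lemma form_sumr (I : finType) (P : pred I) (F : I -> 'rV[R]_n) w :
  b w (\sum_(i | P i) F i) = \sum_(i | P i) b w (F i).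
Proof. by rewrite b_sym form_suml; apply: eq_bigr => i _; rewrite b_sym. Qed.

Lemma form_deltar u v : b u v = \sum_j v 0 j * b u (delta_mx 0 j).
Proof.
rewrite {1}(row_sum_delta v) form_sumr.
by apply: eq_bigr => j _; rewrite formZr.
Qed.

Lemma form_delta u v :
  b u v = \sum_i \sum_j u 0 i * v 0 j * b (delta_mx 0 i) (delta_mx 0 j).
Proof.
rewrite {1}(row_sum_delta u) form_suml; apply: eq_bigr => i _.
rewrite formZl form_deltar mulr_sumr.
by apply: eq_bigr => j _; rewrite mulrA.
Qed.

Definition form_gram : 'M[R]_n := \matrix_(i, j) b (delta_mx 0 i) (delta_mx 0 j).

Lemma form_gramE u v : b u v = (u *m form_gram *m v^T) 0 0.
Proof.
rewrite form_delta mxE exchange_big /=; apply: eq_bigr => j _.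
rewrite !mxE mulr_suml; apply: eq_bigr => i _; rewrite !mxE.
by rewrite mulrAC.
Qed.

Hypothesis b_pos : forall u, u != 0 -> 0 < b u u.

Lemma form_ge0 u : 0 <= b u u.
Proof. by have [->|/b_pos/ltW //] := eqVneq u 0; rewrite form0l. Qed.

(** A row u of the kernel satisfies b(u, u) = u G u^T = 0, so it vanishes by positivity. *)
Lemma form_gram_unit : form_gram \in unitmx.
Proof.
rewrite -row_free_unit -kermx_eq0; apply/eqP/row_matrixP => i; rewrite row0.
apply/eqP; apply: contraT => /b_pos; rewrite form_gramE.
by rewrite -row_mul mulmx_ker row0 mul0mx mxE ltxx.
Qed.

(** Supplies the existence of gradients. The witness is the row of values of [f] on the basis,
    multiplied by the inverse Gram matrix. *)
Lemma form_riesz (f : 'rV[R]_n -> R) :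
  (forall a u v, f (a *: u + v) = a * f u + f v) ->
  exists G, forall w, b G w = f w.
Proof.
move=> fl.
have fD u v : f (u + v) = f u + f v by rewrite -[u in LHS]scale1r fl mul1r.
have f0 : f 0 = 0 by apply: (@addIr _ (f 0)); rewrite -fD !add0r.
have fZ a u : f (a *: u) = a * f u by rewrite -[_ *: _]addr0 fl f0 addr0.
exists ((\row_j f (delta_mx 0 j)) *m invmx form_gram) => w.
rewrite form_gramE mulmxKV ?form_gram_unit // mxE.
rewrite {2}(row_sum_delta w) (big_morph f fD f0).
by apply: eq_bigr => j _; rewrite fZ !mxE mulrC.
Qed.

Lemma form_cauchy_schwarz u v :
  `|b u v| <= Num.sqrt (b u u) * Num.sqrt (b v v).
Proof.
rewrite -sqrtrM ?form_ge0 // -sqrtr_sqr ler_wsqrtr //.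
have [->|v0] := eqVneq v 0; first by rewrite b_sym !form0l mulr0 expr0n.
have vv := b_pos v0.
(* This is the component of [u] orthogonal to [v], scaled by b(v, v) to avoid a division. *)
have := form_ge0 (b v v *: u - b u v *: v).
have -> : b (b v v *: u - b u v *: v) (b v v *: u - b u v *: v) =
    b v v * (b u u * b v v - b u v ^+ 2).
  rewrite formDl !formDr !(formNl, formNr) !(formZl, formZr) (b_sym v u).
  by ring.
by rewrite pmulr_rge0 // subr_ge0.
Qed.

End SymmetricForms.

(** * Bilinear forms with varying coefficients *)

Section BilinearFamilies.
Context {R : realType} {n : nat} {W : normedModType R}.

Lemma is_derive_sum_fun (V : normedModType R) (k : nat) (h : 'I_k -> V -> R^o)
    (x v : V) (dh : 'I_k -> R^o) :
  (forall i, is_derive x v (h i) (dh i)) ->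
  is_derive x v (fun s => \sum_(i < k) h i s : R^o) (\sum_(i < k) dh i).
Proof.
move=> H; have := is_derive_sum H.
by congr is_derive; apply/funext => s; rewrite fct_sumE.
Qed.

Lemma cvg_ord_sum (T : Type) (F : set_system T) (FF : Filter F) (k : nat)
    (h : 'I_k -> T -> R^o) (l : 'I_k -> R^o) :
  (forall i, h i @ F --> l i) ->
  \sum_(i < k) h i s @[s --> F] --> \sum_(i < k) l i.
Proof. by move=> hl; apply: cvg_big => //; exact: add_continuous. Qed.

Lemma is_derive_coord (X : W -> 'rV[R]_n) (a w : W) i :
  derivable X a w -> is_derive a w (fun s => X s 0 i : R^o) ('D_w X a 0 i).
Proof.
move=> dX; rewrite derive_mx // mxE; apply/derivableP.
by move/derivable_mxP : dX; apply.
Qed.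

Variables (B : 'rV[R]_n -> 'rV[R]_n -> 'rV[R]_n -> R^o).
Hypothesis B_linear :
  forall y w a u v, B y (a *: u + v) w = a * B y u w + B y v w.
Hypothesis B_sym : forall y u v, B y u v = B y v u.

(** Differentiability of [B] is given only for fixed vector arguments. Expanding both arguments in
    the standard basis reduces the claim to the product rule for scalar functions. *)
Lemma is_derive_form (x X Y : W -> 'rV[R]_n) (a w : W) :
  differentiable x a ->
  (forall u v, differentiable (fun y => B y u v) (x a)) ->
  derivable X a w -> derivable Y a w ->
  is_derive a w (fun s => B (x s) (X s) (Y s))
    ('D_('D_w x a) (fun y => B y (X a) (Y a)) (x a)
     + (B (x a) ('D_w X a) (Y a) + B (x a) (X a) ('D_w Y a))).
Proof.
move=> dx dB dX dY.
pose e i : 'rV[R]_n := delta_mx 0 i.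
have Be y u v : B y u v = \sum_i \sum_j u 0 i * v 0 j * B y (e i) (e j).
  exact: form_delta (B_linear y) (B_sym y) u v.
have dBx u v :
    is_derive a w (fun s => B (x s) u v) ('D_('D_w x a) (fun y => B y u v) (x a)).
  have dc : differentiable ((fun y => B y u v) \o x) a.
    exact: differentiable_comp.
  apply: DeriveDef; first exact: diff_derivable.
  by rewrite (deriveE _ dc) (diff_comp dx (dB _ _)) /= -(deriveE _ dx) -deriveE.
have -> : 'D_('D_w x a) (fun y => B y (X a) (Y a)) (x a) =
    \sum_i \sum_j X a 0 i * Y a 0 j * 'D_('D_w x a) (fun y => B y (e i) (e j)) (x a).
  rewrite (_ : (fun y => _) = (fun y =>
      \sum_i \sum_j X a 0 i * Y a 0 j * B y (e i) (e j) : R^o)); last first.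
    by apply/funext => y; exact: Be.
  apply: derive_val.
  apply: is_derive_sum_fun => i; apply: is_derive_sum_fun => j.
  by apply: is_deriveZ; apply/derivableP/diff_derivable.
rewrite (_ : (fun s => _) = (fun s =>
    \sum_i \sum_j X s 0 i * Y s 0 j * B (x s) (e i) (e j) : R^o)); last first.
  by apply/funext => y; exact: Be.
rewrite (Be _ _ (Y a)) (Be _ (X a)) -!big_split /=.
apply: is_derive_sum_fun => i; rewrite -!big_split /=.
apply: is_derive_sum_fun => j.
have H := is_deriveM (is_deriveM (is_derive_coord i dX) (is_derive_coord j dY))
  (dBx (e i) (e j)).
apply: (@is_derive_eq _ _ _ _ _ _ _ _ H).
have leibniz (p p' r r' c d : R) :
  (p * r) * d + c * (p * r' + r * p') = p * r * d + (p' * r * c + p * r' * c) by ring.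
exact: leibniz.
Qed.

Lemma cvg_form (T : Type) (F : set_system T) (FF : Filter F)
    (x X Y : T -> 'rV[R]_n) (x0 X0 Y0 : 'rV[R]_n) :
  x @ F --> x0 -> (forall u v, {for x0, continuous (fun y => B y u v)}) ->
  X @ F --> X0 -> Y @ F --> Y0 ->
  B (x s) (X s) (Y s) @[s --> F] --> B x0 X0 Y0.
Proof.
move=> cx cB cX cY.
pose e i : 'rV[R]_n := delta_mx 0 i.
have Be y u v : B y u v = \sum_i \sum_j u 0 i * v 0 j * B y (e i) (e j).
  exact: form_delta (B_linear y) (B_sym y) u v.
rewrite (_ : (fun s => _) = (fun s =>
    \sum_i \sum_j X s 0 i * Y s 0 j * B (x s) (e i) (e j) : R^o)); last first.
  by apply/funext => y; exact: Be.
have coord (Z : T -> 'rV[R]_n) (Z0 : 'rV[R]_n) i :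
    Z @ F --> Z0 -> (Z s 0 i : R^o) @[s --> F] --> (Z0 0 i : R^o).
  move=> cZ; apply: (@cvg_comp _ _ _ Z (fun M : 'rV[R]_n => M 0 i : R^o)) cZ _.
  exact: coord_continuous.
rewrite Be; apply: cvg_ord_sum => i; apply: cvg_ord_sum => j.
apply: cvgM; first by apply: cvgM; exact: coord.
exact: cvg_comp cx (cB _ _).
Qed.

End BilinearFamilies.

(** * Local Riemannian geometry *)

Section LocalGeometry.
Context {R : realType} {n : nat} {Q : riemannian R n}.
Implicit Types (p q z : Q) (x y u v w : 'rV[R]_n).

Lemma transition_nbhs p q x : cimg (chart_at p) x ->
  cdom (chart_at q) (cinv (chart_at p) x) ->
  \forall y \near x, cimg (chart_at p) y /\ cdom (chart_at q) (cinv (chart_at p) y).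
Proof.
move=> px qx.
have h1 : \forall y \near x, cimg (chart_at p) y.
  by apply: open_nbhs_nbhs; split => //; exact: cimg_open.
have h2 : \forall y \near x, cdom (chart_at q) (cinv (chart_at p) y).
  apply: (cinv_cont px); apply: open_nbhs_nbhs; split => //.
  exact: cdom_open.
exact: filterI h1 h2.
Qed.

Lemma transition_differentiable p q x : cimg (chart_at p) x ->
  cdom (chart_at q) (cinv (chart_at p) x) ->
  differentiable (chart_at q \o cinv (chart_at p)) x.
Proof. by move=> px qx; have [+ _] := chart_at_smooth p q 1; apply; split. Qed.

Lemma near_id_diff (V : normedModType R) (f : V -> V) (a v : V) :
  (\forall x \near a, f x = x) -> differentiable f a -> 'd f a v = v.
Proof.
move=> fid df; rewrite -deriveE // -[RHS](derive_id a v).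
exact: near_eq_derive.
Qed.

(** Going to the other chart and back is the identity only near [x], where both charts are defined;
    this is enough for the chain rule to make the two differentials inverse to each other. *)
Lemma transitionK p q x u : cimg (chart_at p) x ->
  cdom (chart_at q) (cinv (chart_at p) x) ->
  'd (chart_at p \o cinv (chart_at q)) (chart_at q (cinv (chart_at p) x))
    ('d (chart_at q \o cinv (chart_at p)) x u) = u.
Proof.
move=> px qx.
have d1 := transition_differentiable px qx.
have d2 : differentiable (chart_at p \o cinv (chart_at q))
    ((chart_at q \o cinv (chart_at p)) x).
  apply: transition_differentiable; first exact: cmap_img.
  by rewrite /= cmapK //; exact: cinv_dom.
have := congr1 (fun f => f u) (diff_comp d1 d2) => /= <-.
apply: near_id_diff; last exact: differentiable_comp.
have := transition_nbhs px qx.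
by apply: filterS => y [py qy] /=; rewrite cmapK // cinvK.
Qed.

Lemma cimg_center p : cimg (chart_at p) (chart_at p p).
Proof. by apply: cmap_img; exact: chart_atP. Qed.

Lemma tcoord_center p (u : tangent p) : tcoord (chart_at p) u = u.
Proof.
have px := cimg_center p.
have pp : cdom (chart_at p) (cinv (chart_at p) (chart_at p p)).
  by rewrite cmapK; exact: chart_atP.
apply: near_id_diff; last exact: transition_differentiable.
have := transition_nbhs px pp.
by apply: filterS => y [py _] /=; rewrite cinvK.
Qed.

(** Lets the metric at all points near [p] be read in one chart; [tvect] undoes [tcoord] by
    [transitionK]. *)
Lemma metric_tcoord p z (u v : tangent z) : cdom (chart_at p) z ->
  metric u v =
  lmetric (chart_at p) (chart_at p z)
    (tcoord (chart_at p) u) (tcoord (chart_at p) v).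
Proof.
move=> pz; have zz := cimg_center z; have zK := cmapK (chart_atP z).
have h w : 'd (chart_at z \o cinv (chart_at p)) (chart_at p z)
    ('d (chart_at p \o cinv (chart_at z)) (chart_at z z) w) = w.
  by have := transitionK w zz (q := p); rewrite zK; exact.
rewrite /lmetric /tvect cmapK // /tcoord.
exact: (congr2 (fun a b : 'rV[R]_n => metric (a : tangent z) (b : tangent z))
  (esym (h u)) (esym (h v))).
Qed.

Lemma lmetric_center p u v :
  lmetric (chart_at p) (chart_at p p) u v = metric (u : tangent p) (v : tangent p).
Proof.
rewrite (@metric_tcoord p p u v (chart_atP p)).
by rewrite !tcoord_center.
Qed.

Lemma lmetric_linear p y w (a : R) u v :
  lmetric (chart_at p) y (a *: u + v) w =
  a * lmetric (chart_at p) y u w + lmetric (chart_at p) y v w.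
Proof. by rewrite /lmetric /tvect linearP; exact: metric_linear. Qed.

Lemma lmetric_sym p y u v :
  lmetric (chart_at p) y u v = lmetric (chart_at p) y v u.
Proof. by rewrite /lmetric Defs.metric_sym. Qed.

Lemma lmetric_pos p y u : cimg (chart_at p) y -> u != 0 ->
  0 < lmetric (chart_at p) y u u.
Proof.
move=> py u0; apply: Defs.metric_pos; apply: contra_neq u0 => tu0.
rewrite -(transitionK u py (chart_atP _)).
by rewrite -[X in 'd _ _ X]/(tvect (chart_at p) y u) tu0 linear0.
Qed.

Lemma lmetric_differentiable p y u v : cimg (chart_at p) y ->
  differentiable (fun x => lmetric (chart_at p) x u v) y.
Proof. by move=> py; have [+ _] := metric_smooth p u v 1; exact. Qed.

Lemma lmetric_derivable_derive p y u v w w' : cimg (chart_at p) y ->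
  derivable (fun x => 'D_w (fun x => lmetric (chart_at p) x u v) x) y w'.
Proof.
move=> py; apply: diff_derivable.
by have [_ /(_ w) [+ _]] := metric_smooth p u v 2; exact.
Qed.

Lemma gram_unit p y : cimg (chart_at p) y -> gram (chart_at p) y \in unitmx.
Proof.
move=> py; apply: (@form_gram_unit _ _ (lmetric (chart_at p) y)).
- exact: lmetric_linear.
- exact: lmetric_sym.
- by move=> u; exact: lmetric_pos.
Qed.

(** The Koszul formula for constant fields. Pairing with the metric multiplies by the Gram matrix
    and cancels the inverse in [christoffel]; linearity in [v], both as an argument and as a
    direction, then sums up the basis components. *)
Lemma lmetric_christoffel p y u v w : cimg (chart_at p) y ->
  lmetric (chart_at p) y (christoffel (chart_at p) y w u) v =
  2^-1 * ('D_w (fun x => lmetric (chart_at p) x u v) y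
          + 'D_u (fun x => lmetric (chart_at p) x w v) y
          - 'D_v (fun x => lmetric (chart_at p) x w u) y).
Proof.
move=> py.
pose L := lmetric (chart_at p).
have dL a b : differentiable (fun x => L x a b) y by exact: lmetric_differentiable.
have Dr a b c : 'D_c (fun x => L x a b) y =
    \sum_l b 0 l * 'D_c (fun x => L x a (delta_mx 0 l)) y.
  rewrite (_ : (fun x => L x a b) =
      fun x => \sum_l b 0 l * L x a (delta_mx 0 l) : R^o); last first.
    apply/funext => x; apply: (@form_deltar _ _ (L x)).
      exact: lmetric_linear.
    exact: lmetric_sym.
  apply: derive_val; apply: is_derive_sum_fun => l.
  by apply: is_deriveZ; apply/derivableP/diff_derivable.
have Dd a b c : 'D_c (fun x => L x a b) y =
    \sum_l c 0 l * 'D_(delta_mx 0 l) (fun x => L x a b) y.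
  rewrite (deriveE _ (dL _ _)) {1}(row_sum_delta c) linear_sum.
  by apply: eq_bigr => l _; rewrite linearZ /= (deriveE _ (dL _ _)).
rewrite (form_gramE (@lmetric_linear p y) (@lmetric_sym p y)).
rewrite -[form_gram _]/(gram (chart_at p) y) /christoffel -!scalemxAl.
rewrite mulmxKV ?gram_unit // !mxE.
congr (_ * _); rewrite (Dr u v w) (Dr w v u) (Dd w u v).
rewrite -big_split -sumrB /=; apply: eq_bigr => l _.
by rewrite !mxE -mulrDr -mulrBr mulrC.
Qed.

(** In the sum of the two Koszul formulas the derivatives in the directions [u] and [v] cancel, and
    the two halves of the derivative along [w] add up. *)
Lemma metric_compatible p y u v w : cimg (chart_at p) y ->
  'D_w (fun x => lmetric (chart_at p) x u v) y =
  lmetric (chart_at p) y (christoffel (chart_at p) y w u) v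
  + lmetric (chart_at p) y u (christoffel (chart_at p) y w v).
Proof.
move=> py; rewrite (lmetric_sym _ _ u) !lmetric_christoffel //.
have -> : (fun x => lmetric (chart_at p) x v u) = fun x => lmetric (chart_at p) x u v.
  by apply/funext => x; exact: lmetric_sym.
set a := 'D_w _ y; set b := 'D_u _ y; set c := 'D_v _ y.
by field.
Qed.

End LocalGeometry.

(** * Derivability of determinants and inverse matrices *)

Section DerivableMatrices.
Context {R : realType} {V : normedModType R}.
Implicit Types (x v : V).

Lemma derivable_bigsum (I : Type) (r : seq I) (F : I -> V -> R^o) x v :
  (forall i, derivable (F i) x v) ->
  derivable (fun y => \sum_(i <- r) F i y : R^o) x v.
Proof.
move=> dF; elim: r => [|i r IH].
  rewrite (_ : (fun y => _) = cst 0); last by apply/funext => y; rewrite big_nil.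
  exact: derivable_cst.
rewrite (_ : (fun y => _) = F i + (fun y => \sum_(j <- r) F j y : R^o)).
  exact: derivableD.
by apply/funext => y; rewrite big_cons.
Qed.

Lemma derivable_bigprod (I : Type) (r : seq I) (F : I -> V -> R^o) x v :
  (forall i, derivable (F i) x v) ->
  derivable (fun y => \prod_(i <- r) F i y : R^o) x v.
Proof.
move=> dF; elim: r => [|i r IH].
  rewrite (_ : (fun y => _) = cst 1); last by apply/funext => y; rewrite big_nil.
  exact: derivable_cst.
rewrite (_ : (fun y => _) = F i * (fun y => \prod_(j <- r) F j y : R)).
  exact: derivableM.
by apply/funext => y; rewrite big_cons.
Qed.

Lemma derivable_cstM (a : R) (f : V -> R^o) x v :
  derivable f x v -> derivable (fun y => a * f y : R^o) x v.
Proof. by move=> df; apply: (@derivableM _ _ (cst a) f) => //; exact: derivable_cst. Qed.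

Lemma derivable_det k (M : V -> 'M[R]_k) x v :
  (forall i j, derivable (fun y => M y i j : R^o) x v) ->
  derivable (fun y => \det (M y) : R^o) x v.
Proof.
move=> dM; apply: derivable_bigsum => s; apply: derivable_cstM.
by apply: derivable_bigprod => i.
Qed.

Lemma derivable_invmx k (M : V -> 'M[R]_k) x v i j :
  (forall i j, derivable (fun y => M y i j : R^o) x v) ->
  (\forall y \near x, M y \in unitmx) ->
  derivable (fun y => invmx (M y) i j : R^o) x v.
Proof.
move=> dM uM.
have ux : \det (M x) != 0 by rewrite -unitfE; exact: (nbhs_singleton uM).
(* Cramer's formula. On a singular matrix [invmx] returns the matrix itself, so the formula is used
   only near [x], where [M] is invertible. *)
have -> : derivable (fun y => invmx (M y) i j : R^o) x v =
    derivable (fun y => (\det (M y))^-1 * cofactor (M y) j i : R^o) x v.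
  apply/propext; split; apply: near_eq_derivable; apply: filterS uM => y uy;
    by rewrite /invmx uy !mxE.
apply: (@derivableM _ _ (fun y => (\det (M y))^-1) (fun y => cofactor (M y) j i)).
  by apply: derivableV => //; exact: derivable_det.
apply: derivable_cstM; apply: derivable_det => a b.
rewrite (_ : (fun y => _) = fun y => M y (lift j a) (lift i b)) //.
by apply/funext => y; rewrite !mxE.
Qed.

End DerivableMatrices.

(** * Curvature in a chart *)

Section Curvature.
Context {R : realType} {n : nat} {Q : riemannian R n}.
Implicit Types (p : Q) (x y u v w : 'rV[R]_n).

Lemma cimg_nbhs p y : cimg (chart_at p) y -> \forall x \near y, cimg (chart_at p) x.
Proof. by move=> py; apply: open_nbhs_nbhs; split => //; exact: cimg_open. Qed.

Lemma christoffel_derivable p y u v w : cimg (chart_at p) y ->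
  derivable (fun x => christoffel (chart_at p) x u v) y w.
Proof.
move=> py; apply/derivable_mxP => i k.
rewrite (_ : (fun x => _) = fun x => 2^-1 * \sum_l
    ('D_u (fun x => lmetric (chart_at p) x v (delta_mx 0 l)) x
     + 'D_v (fun x => lmetric (chart_at p) x u (delta_mx 0 l)) x
     - 'D_(delta_mx 0 l) (fun x => lmetric (chart_at p) x u v) x)
    * invmx (gram (chart_at p) x) l k : R^o); last first.
  apply/funext => x; rewrite !mxE; congr (_ * _); apply: eq_bigr => l _.
  by rewrite !mxE.
apply: derivable_cstM; apply: derivable_bigsum => l.
apply: (@derivableM _ _ (fun x =>
    'D_u (fun x => lmetric (chart_at p) x v (delta_mx 0 l)) x
     + 'D_v (fun x => lmetric (chart_at p) x u (delta_mx 0 l)) x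
     - 'D_(delta_mx 0 l) (fun x => lmetric (chart_at p) x u v) x)).
  apply: derivableB; first apply: derivableD;
    exact: lmetric_derivable_derive.
apply: derivable_invmx => [a b|].
  rewrite (_ : (fun x => _) =
      fun x => lmetric (chart_at p) x (delta_mx 0 a) (delta_mx 0 b)).
    by apply: diff_derivable; exact: lmetric_differentiable.
  by apply/funext => x; rewrite !mxE.
by apply: filterS (cimg_nbhs py) => x; exact: gram_unit.
Qed.

Lemma christoffel0l p y w : christoffel (chart_at p) y 0 w = 0.
Proof.
rewrite /christoffel (_ : \row_l _ = 0) ?mul0mx ?scaler0 //.
apply/rowP => l; rewrite !mxE derive0 add0r.
have L0 a : (fun x => lmetric (chart_at p) x 0 a) = cst 0.
  apply/funext => x; apply: (@form0l _ _ (lmetric (chart_at p) x)).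
  exact: lmetric_linear.
by rewrite !L0 !derive_cst subrr.
Qed.

(** Constant fields commute, which removes the bracket term, and [nabla] of one along another is
    just its Christoffel term. *)
Lemma curvature_field_cst p y u v w :
  curvature_field (chart_at p) (cst u) (cst v) (cst w) y =
  'D_u (fun x => christoffel (chart_at p) x v w) y
  + christoffel (chart_at p) y u (christoffel (chart_at p) y v w)
  - ('D_v (fun x => christoffel (chart_at p) x u w) y
     + christoffel (chart_at p) y v (christoffel (chart_at p) y u w)).
Proof.
have nablaE a b : nabla (chart_at p) (cst a) (cst b) =
    fun x => christoffel (chart_at p) x a b.
  by apply/funext => x; rewrite /nabla derive_cst add0r.
have lie0 : lie (cst u) (cst v) y = 0 by rewrite /lie !derive_cst subrr.
rewrite /curvature_field !nablaE {3}/nabla lie0 derive_cst christoffel0l.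
by rewrite addr0 subr0.
Qed.

(** Metric compatibility is used twice: first to write D_u g(v, v) as 2 g(Gamma(u, v), v) near [y],
    then for the dependence of g itself on the point when this is differentiated along [w]. *)
Lemma derive2_lmetric p y u v w : cimg (chart_at p) y ->
  'D_w (fun x => 'D_u (fun x => lmetric (chart_at p) x v v) x) y =
  2 * (lmetric (chart_at p) y
         (christoffel (chart_at p) y w (christoffel (chart_at p) y u v)) v
       + lmetric (chart_at p) y
           (christoffel (chart_at p) y u v) (christoffel (chart_at p) y w v)
       + lmetric (chart_at p) y
           ('D_w (fun x => christoffel (chart_at p) x u v) y) v).
Proof.
move=> py.
rewrite (@near_eq_derive _ _ _ _ (fun x => 2 *
  lmetric (chart_at p) x (christoffel (chart_at p) x u v) v : R^o)); last first.
  apply: filterS (cimg_nbhs py) => x px; rewrite metric_compatible //.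
  by rewrite [X in _ + X]lmetric_sym -mulr2n mulr_natl.
have H := @is_derive_form _ _ _ (lmetric (chart_at p)) (@lmetric_linear _ _ _ p)
  (@lmetric_sym _ _ _ p) id (fun x => christoffel (chart_at p) x u v) (cst v) y w.
have dy : differentiable (@id 'rV[R]_n) y by have [] := is_diff_id y.
have {}H := H dy
  (fun a b => lmetric_differentiable a b py) (christoffel_derivable py)
  (derivable_cst _ _ _).
have -> := derive_val (is_derive := is_deriveZ 2 H).
have L0 : lmetric (chart_at p) y (christoffel (chart_at p) y u v) 0 = 0.
  by rewrite lmetric_sym (form0l (@lmetric_linear _ _ _ p y)).
by rewrite derive_id derive_cst /= metric_compatible // L0 addr0.
Qed.

(* The two mixed second derivatives of [g(v, v)] agree; differentiating with
   metric compatibility turns their difference into [2 g(R(u, v) v, v)]. *)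
Lemma curvature_orthogonal p (u v : tangent p) :
  metric (curvature u v v) v = 0.
Proof.
have py := cimg_center p.
have lin := @lmetric_linear _ _ _ p (chart_at p p).
have sym := @lmetric_sym _ _ _ p (chart_at p p).
have E : 'D_u (fun x => 'D_v (fun x => lmetric (chart_at p) x v v) x) (chart_at p p) =
    'D_v (fun x => 'D_u (fun x => lmetric (chart_at p) x v v) x) (chart_at p p).
  exact: (derive_comm u v (@cimg_open _ _ _ (chart_at p)) py (metric_smooth p v v 2)).
have {}E := etrans (esym (derive2_lmetric v v u py))
  (etrans E (derive2_lmetric u v v py)).
rewrite -lmetric_center /curvature curvature_field_cst.
exact: (form_mixed_cancel lin sym E).
Qed.

End Curvature.

(** * Calculus along curves *)

Section CurveCalculus.
Context {R : realType} {n : nat} {Q : riemannian R n}.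
Implicit Types (A : set R) (q : R -> Q) (t : R).

Lemma chart_nbhs A q t : q s @[s --> within A (nbhs t)] --> q t ->
  \forall s \near within A (nbhs t), cdom (chart_at (q t)) (q s).
Proof.
move=> cq; apply: (cq (cdom (chart_at (q t)))).
by apply: open_nbhs_nbhs; split; [exact: cdom_open|exact: chart_atP].
Qed.

Lemma chart_curve_cvg A q t : q s @[s --> within A (nbhs t)] --> q t ->
  chart_at (q t) (q s) @[s --> within A (nbhs t)] --> chart_at (q t) (q t).
Proof.
move=> cq; apply: (@cvg_comp _ _ _ q (chart_at (q t)) _ (nbhs (q t))) => //.
exact: (cmap_cont (chart_atP _)).
Qed.

Lemma metric_curve_cvg A q (X Y : forall s, tangent (q s)) t :
  q s @[s --> within A (nbhs t)] --> q t ->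
  cov_derivable A X t -> cov_derivable A Y t ->
  (metric (X s) (Y s) : R^o) @[s --> within A (nbhs t)] --> (metric (X t) (Y t) : R^o).
Proof.
move=> cq /derivable_within_cvg cX /derivable_within_cvg cY.
have qt := chart_atP (q t); have xt := cimg_center (q t).
rewrite (metric_tcoord (X t) (Y t) qt).
have H : lmetric (chart_at (q t)) (chart_at (q t) (q s))
    (tcoord (chart_at (q t)) (X s)) (tcoord (chart_at (q t)) (Y s))
    @[s --> within A (nbhs t)] -->
    lmetric (chart_at (q t)) (chart_at (q t) (q t))
      (tcoord (chart_at (q t)) (X t)) (tcoord (chart_at (q t)) (Y t)).
  apply: (cvg_form (@lmetric_linear _ _ _ (q t)) (@lmetric_sym _ _ _ (q t))) => //.
    exact: chart_curve_cvg.
  by move=> u v; apply: differentiable_continuous; exact: lmetric_differentiable.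
apply: cvg_trans H; apply: near_eq_cvg.
by apply: filterS (chart_nbhs cq) => s qs; rewrite -metric_tcoord.
Qed.

(** In the chart around [q t] the product rule has an extra term, the derivative of the metric
    coefficients along the velocity. By [metric_compatible] it is exactly the two Christoffel terms
    that turn coordinate derivatives into covariant ones. *)
Lemma metric_curve_derive A q (X Y : forall s, tangent (q s)) t :
  A° t -> q s @[s --> within A (nbhs t)] --> q t ->
  derivable_within A (chart_at (q t) \o q) t ->
  cov_derivable A X t -> cov_derivable A Y t ->
  is_derive t 1 (fun s => metric (X s) (Y s) : R^o)
    (metric (cov_derive A X t) (Y t) + metric (X t) (cov_derive A Y t)).
Proof.
move=> At cq dq dX dY.
have qt := chart_atP (q t); have xt := cimg_center (q t).
have {}dq := derivable_within_interior At dq.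
have {}dX := derivable_within_interior At dX.
have {}dY := derivable_within_interior At dY.
have nq : \forall s \near t, lmetric (chart_at (q t)) (chart_at (q t) (q s))
    (tcoord (chart_at (q t)) (X s)) (tcoord (chart_at (q t)) (Y s)) = metric (X s) (Y s).
  have := chart_nbhs cq; rewrite within_interior //.
  by apply: filterS => s qs; rewrite -metric_tcoord.
apply: (near_eq_is_derive nq).
have dqt : differentiable (chart_at (q t) \o q) t := proj1 (derivable1_diffP _ _) dq.
have := is_derive_form (@lmetric_linear _ _ _ (q t)) (@lmetric_sym _ _ _ (q t))
  dqt (fun u v => lmetric_differentiable u v xt) dX dY.
rewrite !tcoord_center metric_compatible //= -!(derive_within_interior _ At).
move=> H; apply: (@is_derive_eq _ _ _ _ _ _ _ _ H).
have lin := @lmetric_linear _ _ _ (q t) (chart_at (q t) (q t)).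
have sym := @lmetric_sym _ _ _ (q t) (chart_at (q t) (q t)).
rewrite -!lmetric_center /cov_derive.
rewrite (formDl lin) (formDr lin sym) /velocity.
exact: (etrans (addrACA _ _ _ _) (congr2 +%R (addrC _ _) (addrC _ _))).
Qed.

Lemma metric_form (p : Q) (w : 'rV[R]_n) (a : R) (u v : 'rV[R]_n) :
  metric (a *: u + v : tangent p) (w : tangent p) =
  a * metric (u : tangent p) (w : tangent p) + metric (v : tangent p) (w : tangent p).
Proof. exact: metric_linear. Qed.

(** [grad] is defined by choice; [form_riesz] shows that the set chosen from is inhabited. *)
Lemma grad_metric (f : Q -> R) (p : Q) (w : tangent p) :
  metric (grad f p) w = 'd ((f : Q -> R^o) \o cinv (chart_at p)) (chart_at p p) w.
Proof.
have [|G HG] := @form_riesz _ _ _ (@metric_form p)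
    (@Defs.metric_sym _ _ Q p) (@Defs.metric_pos _ _ Q p)
    ('d ((f : Q -> R^o) \o cinv (chart_at p)) (chart_at p p)).
  by move=> a u v; rewrite linearP.
have ex : exists G, [set G : 'rV[R]_n | forall w : 'rV[R]_n,
    metric (G : tangent p) (w : tangent p) =
    'd ((f : Q -> R^o) \o cinv (chart_at p)) (chart_at p p) w] G by exists G.
exact: (getPex ex w).
Qed.

(** * Potentials along a pair of curves *)

Section Potential.
Variables (V : Q -> Q -> R) (A : set R) (q1 q2 : R -> Q) (t : R).
Hypothesis C1V : C1_potential V.
Hypothesis cq1 : q1 s @[s --> within A (nbhs t)] --> q1 t.
Hypothesis cq2 : q2 s @[s --> within A (nbhs t)] --> q2 t.

Let c1 := chart_at (q1 t).
Let c2 := chart_at (q2 t).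

(** The two charts are frozen at time [t], so that near [t] the potential along the curves is a
    fixed function of a curve in a vector space. *)
Definition chart_potential (z : 'rV[R]_n * 'rV[R]_n) : R^o :=
  V (cinv c1 z.1) (cinv c2 z.2).

Lemma chart_potential_differentiable :
  differentiable chart_potential (c1 (q1 t), c2 (q2 t)).
Proof.
by have [+ _] := C1V (q1 t) (q2 t); apply; split; exact: cimg_center.
Qed.

Lemma chart_potential_nbhs : \forall s \near within A (nbhs t),
  chart_potential (c1 (q1 s), c2 (q2 s)) = V (q1 s) (q2 s).
Proof.
apply: filterS2 (chart_nbhs cq1) (chart_nbhs cq2) => s h1 h2.
by rewrite /chart_potential /= !cmapK.
Qed.

Lemma potential_curve_cvg :
  (V (q1 s) (q2 s) : R^o) @[s --> within A (nbhs t)] --> (V (q1 t) (q2 t) : R^o).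
Proof.
have <- : chart_potential (c1 (q1 t), c2 (q2 t)) = V (q1 t) (q2 t).
  by rewrite /chart_potential /= !cmapK //; exact: chart_atP.
have H : chart_potential (c1 (q1 s), c2 (q2 s)) @[s --> within A (nbhs t)] -->
    chart_potential (c1 (q1 t), c2 (q2 t)).
  apply: (@cvg_comp _ _ _ (fun s => (c1 (q1 s), c2 (q2 s))) chart_potential _
    (nbhs (c1 (q1 t), c2 (q2 t)))).
    exact: (cvg_pair (chart_curve_cvg cq1) (chart_curve_cvg cq2)).
  exact: differentiable_continuous chart_potential_differentiable.
by apply: cvg_trans H; apply: near_eq_cvg; exact: chart_potential_nbhs.
Qed.

Hypothesis V_sym : forall x y, V x y = V y x.

(** The differential splits into two partial ones. Symmetry of [V] turns the second into a
    first-argument gradient at [q2 t], the form in which it occurs in the equation of the other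
    agent. *)
Lemma chart_potential_diff w1 w2 :
  'd chart_potential (c1 (q1 t), c2 (q2 t)) (w1, w2) =
  metric (grad1 V (q1 t) (q2 t)) (w1 : tangent (q1 t))
  + metric (grad1 V (q2 t) (q1 t)) (w2 : tangent (q2 t)).
Proof.
have dV := chart_potential_differentiable.
have -> : (w1, w2) = (w1, 0) + (0, w2) :> 'rV[R]_n * 'rV[R]_n.
  by congr pair; rewrite ?addr0 ?add0r.
rewrite linearD; congr (_ + _).
  rewrite grad_metric.
  have dp : differentiable (fun u : 'rV[R]_n => (u, c2 (q2 t))) (c1 (q1 t)).
    by apply: differentiable_pair.
  have E : (V^~ (q2 t) : Q -> R^o) \o cinv c1 =
      chart_potential \o (fun u : 'rV[R]_n => (u, c2 (q2 t))).
    by apply/funext => u; rewrite /chart_potential /= cmapK //; exact: chart_atP.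
  have [_ dpE] := is_diff_pair (is_diff_id (c1 (q1 t)))
    (is_diff_cst (c2 (q2 t)) (c1 (q1 t))).
  have dpw : 'd (fun u : 'rV[R]_n => (u, c2 (q2 t))) (c1 (q1 t)) w1 = (w1, 0).
    exact: (congr1 (fun g => g w1) dpE).
  by rewrite -/c1 E (diff_comp dp) //= dpw.
rewrite grad_metric.
have dp : differentiable (fun u : 'rV[R]_n => (c1 (q1 t), u)) (c2 (q2 t)).
  by apply: differentiable_pair.
have E : (V^~ (q1 t) : Q -> R^o) \o cinv c2 =
    chart_potential \o (fun u : 'rV[R]_n => (c1 (q1 t), u)).
  by apply/funext => u; rewrite /chart_potential /= V_sym cmapK //; exact: chart_atP.
have [_ dpE] := is_diff_pair (is_diff_cst (c1 (q1 t)) (c2 (q2 t)))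
  (is_diff_id (c2 (q2 t))).
have dpw : 'd (fun u : 'rV[R]_n => (c1 (q1 t), u)) (c2 (q2 t)) w2 = (0, w2).
  exact: (congr1 (fun g => g w2) dpE).
by rewrite -/c2 E (diff_comp dp) //= dpw.
Qed.

Lemma potential_curve_derive : A° t ->
  derivable_within A (c1 \o q1) t -> derivable_within A (c2 \o q2) t ->
  is_derive t 1 (fun s => V (q1 s) (q2 s) : R^o)
    (metric (grad1 V (q1 t) (q2 t)) (velocity A q1 t)
     + metric (grad1 V (q2 t) (q1 t)) (velocity A q2 t)).
Proof.
move=> At /(derivable_within_interior At) d1 /(derivable_within_interior At) d2.
have dV := chart_potential_differentiable.
have nV : \forall s \near t, chart_potential (c1 (q1 s), c2 (q2 s)) = V (q1 s) (q2 s).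
  by have := chart_potential_nbhs; rewrite within_interior.
apply: (near_eq_is_derive nV).
have {}d1 : differentiable (c1 \o q1) t := proj1 (derivable1_diffP _ _) d1.
have {}d2 : differentiable (c2 \o q2) t := proj1 (derivable1_diffP _ _) d2.
have dp : differentiable (fun s => (c1 (q1 s), c2 (q2 s))) t.
  exact: (differentiable_pair d1 d2).
have dVp : differentiable (chart_potential \o (fun s => (c1 (q1 s), c2 (q2 s)))) t.
  exact: differentiable_comp.
apply: DeriveDef; first exact: diff_derivable.
have E1 : 'd (c1 \o q1) t 1 = velocity A q1 t.
  exact: (esym (etrans (derive_within_interior _ At) (deriveE _ d1))).
have E2 : 'd (c2 \o q2) t 1 = velocity A q2 t.
  exact: (esym (etrans (derive_within_interior _ At) (deriveE _ d2))).
rewrite (deriveE _ dVp) (diff_comp dp dV) /= (diff_pair d1 d2) /=.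
apply: etrans (chart_potential_diff (velocity A q1 t) (velocity A q2 t)).
exact: (congr2 (fun a b => 'd chart_potential (c1 (q1 t), c2 (q2 t)) (a, b)) E1 E2).
Qed.

End Potential.
End CurveCalculus.

(** * Conservation of energy *)

Section Energy.
Context {R : realType} {n : nat} {Q : riemannian R n}.

Lemma is_derive_sum_cond (V : normedModType R) (k : nat) (P : pred 'I_k)
    (h : 'I_k -> V -> R^o) (x v : V) (dh : 'I_k -> R^o) :
  (forall i, P i -> is_derive x v (h i) (dh i)) ->
  is_derive x v (fun s => \sum_(i | P i) h i s : R^o) (\sum_(i | P i) dh i).
Proof.
move=> H; rewrite big_mkcond /=.
rewrite (_ : (fun s => _) = fun s => \sum_i (if P i then h i else cst 0) s : R^o).
  apply: is_derive_sum_fun => i; case: ifP => [/H //|_]; exact: is_derive_cst.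
by apply/funext => s; rewrite big_mkcond; apply: eq_bigr => i _; case: ifP.
Qed.

(** With v the velocity, the two copies of g(Dv, D^2 v) cancel; what remains is the term that the
    equation of motion evaluates. *)
Lemma energy_derive (A : set R) (q : R -> Q) (t : R) :
  A° t -> q s @[s --> within A (nbhs t)] --> q t -> cov_velocity_exists A q 3 ->
  is_derive t 1 (fun s => metric (velocity A q s) (cov_velocity A q 2 s)
      - 2^-1 * metric (cov_velocity A q 1 s) (cov_velocity A q 1 s) : R^o)
    (metric (velocity A q t) (cov_velocity A q 3 t)).
Proof.
move=> At cq [dq dD]; have tA := interior_subset At.
have H1 := metric_curve_derive At cq (dq t tA) (dD 0%N isT t tA) (dD 2%N isT t tA).
have H2 := metric_curve_derive At cq (dq t tA) (dD 1%N isT t tA) (dD 1%N isT t tA).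
have H := is_deriveB H1 (is_deriveZ 2^-1 H2).
apply: (@is_derive_eq _ _ _ _ _ _ _ _ H).
have cancel (a a' b : R) : a = a' -> a + b - 2^-1 * (a' + a) = b by move=> ->; lra.
exact: cancel (Defs.metric_sym (cov_velocity A q 1 t) (cov_velocity A q 2 t)).
Qed.

(** Covers the end points too, where [energy_derive] does not apply. *)
Lemma energy_cvg (A : set R) (q : R -> Q) (t : R) :
  A t -> q s @[s --> within A (nbhs t)] --> q t -> cov_velocity_exists A q 3 ->
  (metric (velocity A q s) (cov_velocity A q 2 s)
     - 2^-1 * metric (cov_velocity A q 1 s) (cov_velocity A q 1 s) : R^o)
    @[s --> within A (nbhs t)] -->
  (metric (velocity A q t) (cov_velocity A q 2 t)
     - 2^-1 * metric (cov_velocity A q 1 t) (cov_velocity A q 1 t) : R^o).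
Proof.
move=> tA cq [_ dD].
have H1 := metric_curve_cvg cq (dD 0%N isT t tA) (dD 2%N isT t tA).
have H2 := metric_curve_cvg cq (dD 1%N isT t tA) (dD 1%N isT t tA).
exact: (cvgB H1 (cvgM (cvg_cst _) H2)).
Qed.

(** Pairing the equation of motion with the velocity [v] removes the curvature term by
    [curvature_orthogonal]. *)
Lemma force_work (p : Q) (I : finType) (P : pred I) (a v d : tangent p)
    (G : I -> tangent p) :
  d + curvature a v v = - \sum_(j | P j) (G j : 'rV[R]_n) :> 'rV[R]_n ->
  metric v d = - \sum_(j | P j) metric (G j) v.
Proof.
have lin := @metric_form _ _ Q p.
move=> /(congr1 (fun u : 'rV[R]_n => metric (u : tangent p) v)).
rewrite (formDl lin) (formNl lin) (form_suml lin) curvature_orthogonal addr0.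
by rewrite Defs.metric_sym.
Qed.

Lemma tnorm_metric_le (p : Q) (u w : tangent p) (a b : R) :
  tnorm u <= a -> tnorm w <= b -> `|metric u w| <= a * b.
Proof.
move=> ua wb; have CS := form_cauchy_schwarz (@metric_form _ _ Q p)
  (@Defs.metric_sym _ _ Q p) (@Defs.metric_pos _ _ Q p) u w.
apply: (le_trans CS); apply: ler_pM => //; exact: sqrtr_ge0.
Qed.

End Energy.

(** Exchanging the two ends of each edge shows that [a] and [b] have the same total, so half of
    their joint total is the total of [a]. *)
Lemma symmetric_sum_cancel (R : realType) (s : nat) (E : rel 'I_s)
    (a b : 'I_s -> 'I_s -> R) : symmetric E ->
  (forall l m, E l m -> b l m = a m l) ->
  \sum_l (- \sum_(m | E l m) a l m + 2^-1 * \sum_(m | E l m) (a l m + b l m)) = 0.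
Proof.
move=> Esym ba.
have swap : \sum_l \sum_(m | E l m) b l m = \sum_l \sum_(m | E l m) a l m.
  rewrite (exchange_big_dep xpredT) //=; apply: eq_bigr => m _.
  by apply: eq_big => l; [rewrite Esym|exact: ba].
rewrite big_split /= sumrN -mulr_sumr.
under [X in _ * X]eq_bigr do rewrite big_split /=.
rewrite big_split /= swap; lra.
Qed.

(** The edge contributes once at l = i and once at l = j, two distinct indices by irreflexivity;
    this makes up for the factor 1/2, and all other terms are non-negative. *)
Lemma edge_le_half_sum (R : realType) (s : nat) (E : rel 'I_s)
    (W : 'I_s -> 'I_s -> R) (i j : 'I_s) : symmetric E -> irreflexive E ->
  (forall l m, E l m -> 0 <= W l m) -> (forall l m, E l m -> W l m = W m l) ->
  E i j -> W i j <= \sum_l 2^-1 * \sum_(m | E l m) W l m.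
Proof.
move=> Esym Eirr W0 Wsym Eij.
have ji : j != i by apply: contraTneq Eij => ->; rewrite Eirr.
have S0 l : 0 <= \sum_(m | E l m) W l m by apply: sumr_ge0 => m; exact: W0.
have Sge l m : E l m -> W l m <= \sum_(m' | E l m') W l m'.
  move=> Elm; rewrite (bigD1 m) //= lerDl.
  by apply: sumr_ge0 => m' /andP[]; auto.
have Eji : E j i by rewrite Esym.
rewrite -mulr_sumr (bigD1 i) //= [X in _ + X](bigD1 j) //=.
have := Sge _ _ Eij; have := Sge _ _ Eji; rewrite -(Wsym _ _ Eij).
have : 0 <= \sum_(l | (l != i) && (l != j)) \sum_(m | E l m) W l m.
  by apply: sumr_ge0.
lra.
Qed.

(** Meant for x = g(v, D^2 v) and y = |Dv|^2. The direct estimate gives a^2 / 2; it is relaxed to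
    a^2, the constant in the hypothesis of the theorem. *)
Lemma energy_lower_bound (R : realType) (x y a c : R) :
  `|x| <= c -> `|y| <= a * a -> - (a ^+ 2 + c) <= x - 2^-1 * y.
Proof.
rewrite expr2 !ler_norml => /andP[h1 _] /andP[_ h2].
have h3 : 0 <= a * a by rewrite -expr2 sqr_ge0.
lra.
Qed.

Theorem proposition3 (R : realType) (n : nat) (Q : riemannian R n)
  (hconn : connected [set: Q]) (hcomplete : complete_riemannian Q)
  (s : nat) (hs : (2 <= s)%N) (T : R) (hT : 0 < T)
  (E : rel 'I_s) (hEsym : symmetric E) (hEirr : irreflexive E)
  (q0 qT : 'I_s -> Q)
  (v0 : forall i, tangent (q0 i)) (vT : forall i, tangent (qT i))
  (V : 'I_s -> 'I_s -> Q -> Q -> R)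
  (hVC1 : forall i j, E i j -> C1_potential (V i j))
  (hVge0 : forall i j, E i j -> forall x y, 0 <= V i j x y)
  (hVij : forall i j, E i j -> forall x y, V i j x y = V j i x y)
  (hVsym : forall i j, E i j -> forall x y, V i j x y = V i j y x)
  (r Vstar : 'I_s -> 'I_s -> R)
  (hrsym : forall i j, E i j -> r i j = r j i)
  (hr : forall i j, E i j -> 0 < r i j)
  (hVstar : forall i j, E i j -> 0 < Vstar i j)
  (hVr : forall i j, E i j -> forall x y,
    dist x y < r i j -> Vstar i j < V i j x y)
  (vmax amax etamax : 'I_s -> R)
  (hvmax : forall i, 0 <= vmax i) (hamax : forall i, 0 <= amax i)
  (hetamax : forall i, 0 <= etamax i)
  (hv : forall i, Num.max (tnorm (v0 i)) (tnorm (vT i)) < vmax i)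
  (q : 'I_s -> R -> Q)
  (hq : forall i,
    Omega_max T (v0 i) (vT i) (vmax i) (amax i) (etamax i) (q i))
  (hD4 : forall i, cov_velocity_exists `[0, T]%classic (q i) 3)
  (hODE : forall i t, 0 <= t <= T ->
    cov_velocity `[0, T]%classic (q i) 3 t
    + curvature (cov_velocity `[0, T]%classic (q i) 1 t)
        (velocity `[0, T]%classic (q i) t) (velocity `[0, T]%classic (q i) t)
    = - \sum_(j | E i j) grad1 (V i j) (q i t) (q j t) :> 'rV[R]_n)
  (hbound : forall i j, E i j ->
    \sum_(l < s)
      (amax l ^+ 2 + vmax l * etamax l
       + metric (v0 l)
           (cov_velocity `[0, T]%classic (q l) 2 0 : tangent (q0 l))
       + 2^-1 * \sum_(m | E l m) V l m (q0 l) (q0 m))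
    < Vstar i j) :
  forall i j, E i j -> forall t, 0 <= t <= T -> r i j <= dist (q i t) (q j t).
Proof.
have tA t : 0 <= t <= T -> `[0, T]%classic t by rewrite /= in_itv.
have z0T : 0 <= (0 : R) <= T by rewrite lexx ltW.
have cq i t : 0 <= t <= T ->
    q i s @[s --> within `[0, T]%classic (nbhs t)] --> q i t.
  have [[[/subspace_continuousP cqi _] _ _ _] _ _] := hq i.
  by move=> ht; apply: cqi; exact: tA.
pose W t l m := V l m (q l t) (q m t).
pose K l t : R := metric (velocity `[0, T]%classic (q l) t)
    (cov_velocity `[0, T]%classic (q l) 2 t)
  - 2^-1 * metric (cov_velocity `[0, T]%classic (q l) 1 t)
      (cov_velocity `[0, T]%classic (q l) 1 t).
pose F t : R := \sum_l (K l t + 2^-1 * \sum_(m | E l m) W t l m).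
have Wsym t l m : E l m -> W t l m = W t m l.
  by move=> Elm; rewrite /W hVij // hVsym // hEsym.
have Fder t : t \in `]0, T[ -> is_derive t 1 F 0.
  rewrite in_itv /= => /andP[t0 tT].
  have ht : 0 <= t <= T by rewrite !ltW.
  have At : (`[0, T]%classic)° t.
    have : \forall s \near t, s \in `]0, T[ by apply: near_in_itvoo; rewrite in_itv /= t0.
    by apply: filterS => x; rewrite /= !in_itv /= => /andP[? ?]; rewrite !ltW.
  (* The rate of change of the potential of the edge splits into [a], due to the motion of agent
     [l], and [b], due to that of agent [m]. *)
  pose a l m := metric (grad1 (V l m) (q l t) (q m t)) (velocity `[0, T]%classic (q l) t).
  pose b l m := metric (grad1 (V l m) (q m t) (q l t)) (velocity `[0, T]%classic (q m) t).
  have dK l : is_derive t 1 (K l : R -> R^o) (- \sum_(m | E l m) a l m).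
    rewrite -(force_work (hODE l t ht)).
    exact: energy_derive At (cq l t ht) (hD4 l).
  have dW l m : E l m -> is_derive t 1 (fun s => W s l m : R^o) (a l m + b l m).
    move=> Elm; apply: potential_curve_derive => //.
    - exact: hVC1.
    - exact: cq.
    - exact: cq.
    - exact: hVsym.
    - by have [+ _] := hD4 l; apply; exact: tA.
    - by have [+ _] := hD4 m; apply; exact: tA.
  have <- := @symmetric_sum_cancel R s E a b hEsym.
    apply: is_derive_sum_fun => l; apply: is_deriveD.
    by apply: is_deriveZ; apply: is_derive_sum_cond => m; exact: dW.
  move=> l m Elm; rewrite /b /a.
  (* The potentials must agree as functions, since [grad1] is applied to the whole function. *)
  by have -> : V l m = V m l by apply/funext => x; apply/funext => y; exact: hVij.
have Fcont : {within `[0, T], continuous F}.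
  apply/subspace_continuousP => t; rewrite /= in_itv /= => ht.
  apply: cvg_big => [|l _]; first exact: add_continuous.
  apply: cvgD; first exact: energy_cvg (tA t ht) (cq l t ht) (hD4 l).
  apply: cvgM; first exact: cvg_cst.
  apply: cvg_big => [|m Elm]; first exact: add_continuous.
  exact: potential_curve_cvg (hVC1 l m Elm) (cq l t ht) (cq m t ht).
have Fcst := derive0_constant Fder Fcont.
have F0 : F 0 <= \sum_(l < s) (metric (v0 l)
      (cov_velocity `[0, T]%classic (q l) 2 0 : tangent (q0 l))
    + 2^-1 * \sum_(m | E l m) V l m (q0 l) (q0 m)).
  apply: ler_sum => l _.
  have [[_ _ [ql0 vl0] _] _ _] := hq l.
  have -> : \sum_(m | E l m) V l m (q0 l) (q0 m) = \sum_(m | E l m) W 0 l m.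
    apply: eq_bigr => m _; rewrite /W ql0.
    by have [[_ _ [-> _] _] _ _] := hq m.
  rewrite lerD2r /K.
  (* The sides also differ in the base point, [q0 l] against [q l 0]; [v0 l] is generalized because
     its type mentions the former. *)
  have -> : metric (v0 l) (cov_velocity `[0, T]%classic (q l) 2 0 : tangent (q0 l)) =
      metric (velocity `[0, T]%classic (q l) 0) (cov_velocity `[0, T]%classic (q l) 2 0).
    by rewrite vl0; move: (v0 l) => w; rewrite -ql0.
  rewrite lerBlDr lerDl mulr_ge0 // ?invr_ge0 ?ler0n //.
  apply: (@form_ge0 _ _ (@metric _ _ Q _)); first by move=> *; exact: metric_linear.
  exact: Defs.metric_pos.
move=> i j Eij t ht; rewrite leNgt; apply/negP => dr.
have := hVr _ _ Eij _ _ dr; apply/negP; rewrite -leNgt.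
apply: le_trans (ltW (hbound _ _ Eij)).
have := edge_le_half_sum hEsym hEirr (fun l m Elm => hVge0 l m Elm (q l t) (q m t))
  (Wsym t) Eij.
move=> /le_trans; apply.
have Kt : \sum_(l < s) - (amax l ^+ 2 + vmax l * etamax l) <= \sum_(l < s) K l t.
  apply: ler_sum => l _.
  have [_ _ /(_ t ht)[nv na neta]] := hq l.
  exact: energy_lower_bound (tnorm_metric_le nv neta) (tnorm_metric_le na na).
have sumD (f g : 'I_s -> R) : \sum_l (f l + g l) = \sum_l f l + \sum_l g l.
  by rewrite big_split.
(* Here [x], [y], [z] are the three groups of terms in the hypothesis, [k] and [w] the kinetic and
   potential parts at time [t], and [ft], [f0] the values of [F] at [t] and 0. *)
have bound (x y z k w ft f0 : R) :
  - x <= k -> ft = k + w -> ft = f0 -> f0 <= y + z -> w <= x + y + z by lra.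
rewrite sumrN in Kt; rewrite sumD in F0; rewrite !sumD -sumD.
exact: (bound _ _ _ _ _ _ _ Kt (sumD _ _) (Fcst t ht) F0).
Qed.
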